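(* There is a Lipschitz retraction from the Banach space $X=\overline{\mathrm{span}}\big(\{V_{i,n}: i=1,2,\ n\in\mathbb{N}\}\cup\{U_1,U_2\}\big)\subset\ell_\infty(\mathbb{N}^2)$ onto a generating compact and convex subset of $X$.
   Context: Conventions: $\mathbb{N}=\{1,2,\dots\}$, $\mathbb{N}_0=\mathbb{N}\cup\{0\}$, scalars are real, $\ell_\infty(\Gamma)$ carries the supremum norm. A subset of a Banach space is generating if its closed linear span is the whole space. A retraction onto a subset $N$ of $X$ is a map $R:X\to N$ with $R(x)=x$ for $x\in N$; it is Lipschitz if for some $\lambda\ge 0$ it satisfies $\|R(x)-R(y)\|\le\lambda\|x-y\|$ for all $x,y\in X$. Constants: for a real $M>16$ and $k=1,\dots,8$ put $$x_k=\frac{\frac12+\frac kM}{1-\frac{2k}M},\quad t(k)=\frac12-\frac kM,\quad \alpha=1-x_8,\quad \beta=1+x_1^2,\quad u(k)=\alpha+x_k,\quad v(k)=\beta-x_k^2,$$ $$\delta_M=x_8^2-x_1^2,\qquad \mu_M=\min_{j,k\in\{1,\dots,8\},\,j\ne k}\{(1-t(k))(u(k)-u(j))+t(k)(v(k)-v(j))\}.$$ Fix $\delta>0$ with $\delta<\frac1{10}$; fix $M>16$ large enough that $\frac8M+\delta_M+\mu_M<\frac{1-8\delta}6$ and $\delta_M<\frac\delta3$; fix $\Delta>0$ smaller than each of $\frac{\mu_M}2$, $\frac\delta6$, $\frac{1-2\delta}3-\delta_M$, $\delta_M$, $\frac{1-\delta_M}2$. For $i,k\in\{1,\dots,8\}$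 let $\delta_i(k)=0$ if $i\ne k$ and $\delta_i(i)=\Delta$. Fix a sequence $(e_n)_{n\in\mathbb{N}}$ of norm-one vectors in $\ell_\infty(\mathbb{N})$ such that $\|\sum_n\lambda_ne_n\|=\sum_n|\lambda_n|$ for every finitely supported real sequence $(\lambda_n)$. Vectors in $\ell_\infty(\mathbb{N}^2)$: for $i=1,2$, $$U_i(x)=\begin{cases}u(k)&\text{if }x=(1,8(2m+i-1)+k),\ m\in\mathbb{N}_0,\ k=1,\dots,8,\\ \delta_8(k)&\text{if }x=(1,8(2m-i)+k),\ m\in\mathbb{N},\ k=1,\dots,8,\\ \frac1{10}e_1(k)&\text{if }x=(p,k),\ p,k\in\mathbb{N},\ p\ge2,\end{cases}$$ and for $i=1,2$, $n\in\mathbb{N}$, $V_{i,n}(x)$ equals: - $(-1)^{i-1}\big(\frac{1-\delta}3-\delta_{i+1}(k)\big)$ if $x=(1,8n+k)$, $k=1,\dots,8$; - $v(k)-\frac{2+2\delta}3+(-1)^i\delta_7(k)$ if $x=(1,8(n+1)+k)$, $k=1,\dots,8$; - $(-1)^{i-1}\big(\frac{1-2\delta}3-\delta_6(k)\big)$ if $x=(1,8m+k)$, $k=1,\dots,8$, $m\in\mathbb{N}_0$, $m\equiv n \pmod 2$, $m\ne n$; - $(-1)^{i-1}\frac{1-\delta}3e_1(k)$ if $x=(2n+i-1,k)$, $k\in\mathbb{N}$; - $\frac1{10}e_{2n+i-1}(k)$ if $x=(m,k)$, $m,k\in\mathbb{N}$, $m\ge2$, $m\notin\{2n+i-1,\,2(n+1),\,2(n+1)+1\}$;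 - $0$ otherwise. *)

(* Defs.v *)
From HB Require Import structures.
From mathcomp Require Import all_boot all_order all_algebra.
From mathcomp Require Import all_classical all_reals all_analysis.
From mathcomp Require Import zify.

Set Implicit Arguments.
Unset Strict Implicit.
Unset Printing Implicit Defensive.

Import Order.TTheory GRing.Theory Num.Theory.
Import numFieldNormedType.Exports.

Local Open Scope classical_set_scope.
Local Open Scope ring_scope.

Section EllInfty.
Context (R : realType) (T : Type).

Definition boundedp : {pred T -> R^o} :=
  fun f => f \in (bounded_fun : set (T -> R^o)).

Lemma boundedpP (f : T -> R^o) :
  f \in boundedp <-> exists B, forall x, `|f x| <= B.
Proof.
split.
  move=> /set_mem /pinfty_ex_gt0[B _ hB].
  by exists B => x; exact: hB.
move=> [B hB]; apply/mem_set; exists B; split; first exact: num_real.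
by move=> C BC x _; exact: le_trans (hB x) (ltW BC).
Qed.

Fact boundedp_submod : submod_closed boundedp.
Proof.
split; first by apply/boundedpP; exists 0 => x; rewrite normr0.
move=> a f g /boundedpP[B hB] /boundedpP[C hC]; apply/boundedpP.
exists (`|a| * B + C) => x.
rewrite (le_trans (ler_normD _ _))// lerD//.
by rewrite normrZ ler_wpM2l.
Qed.

HB.instance Definition _ := GRing.isSubmodClosed.Build R (T -> R^o)
  boundedp boundedp_submod.

Record ell_infty : Type := EllInfty {
  ell_val :> T -> R^o ;
  ell_valP : ell_val \in boundedp }.

HB.instance Definition _ := [isSub for ell_val].
HB.instance Definition _ := [Choice of ell_infty by <:].
HB.instance Definition _ := [SubChoice_isSubLmodule of ell_infty by <:].

Implicit Types f g : ell_infty.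

Lemma ell_addE f g x : (f + g) x = f x + g x. Proof. by []. Qed.

Lemma ell_scaleE (a : R) f x : (a *: f) x = a * f x. Proof. by []. Qed.

Lemma ell_ext f g : (forall x, f x = g x) -> f = g.
Proof. by move=> fg; apply/val_inj/funext. Qed.

Definition ell_norm f : R := sup (range (fun x => `|f x|)).

Lemma ell_norm_ub f x : `|f x| <= ell_norm f.
Proof.
apply: ub_le_sup; last by exists x.
have /boundedpP[B hB] := ell_valP f.
by exists B => _ [y _ <-].
Qed.

Lemma ell_norm_le f B : 0 <= B -> (forall x, `|f x| <= B) -> ell_norm f <= B.
Proof.
move=> B0 hB; rewrite /ell_norm; have [->|rf0] := eqVneq (range (fun x => `|f x|)) set0.
  by rewrite sup0.
by apply: ge_sup; [exact/set0P|move=> _ [y _ <-]].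
Qed.

Lemma ell_norm_ge0 f : 0 <= ell_norm f.
Proof.
rewrite /ell_norm; have [->|/set0P[_ [x _ _]]] := eqVneq (range (fun x => `|f x|)) set0.
  by rewrite sup0.
exact: le_trans (normr_ge0 (f x)) (ell_norm_ub f x).
Qed.

Fact ell_normD f g : ell_norm (f + g) <= ell_norm f + ell_norm g.
Proof.
apply: ell_norm_le => [|x]; first by rewrite addr_ge0// ell_norm_ge0.
by rewrite ell_addE (le_trans (ler_normD _ _))// lerD// ell_norm_ub.
Qed.

Fact ell_normZ (a : R) f : ell_norm (a *: f) = `|a| * ell_norm f.
Proof.
have aux (b : R) (g : ell_infty) : ell_norm (b *: g) <= `|b| * ell_norm g.
  apply: ell_norm_le => [|x]; first by rewrite mulr_ge0// ell_norm_ge0.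
  by rewrite ell_scaleE normrM ler_wpM2l// ell_norm_ub.
apply/eqP; rewrite eq_le aux/=.
have [->|a0] := eqVneq a 0; first by rewrite normr0 mul0r ell_norm_ge0.
rewrite -{1}[f](scalerK a0) -ler_pdivlMl ?normr_gt0// -normfV; exact: aux.
Qed.

Fact ell_norm0_eq0 f : ell_norm f = 0 -> f = 0.
Proof.
move=> f0; apply: ell_ext => x; apply/eqP.
by rewrite -normr_le0 -f0 ell_norm_ub.
Qed.

HB.instance Definition _ :=
  Lmodule_isNormed.Build R ell_infty ell_normD ell_normZ ell_norm0_eq0.

Lemma ell_normE f : `|f| = sup (range (fun x => `|f x|)). Proof. by []. Qed.

Lemma ell_le_norm f x : `|f x| <= `|f|. Proof. exact: ell_norm_ub. Qed.

Lemma ell_norm_leP f B : 0 <= B -> (forall x, `|f x| <= B) -> `|f| <= B.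
Proof. exact: ell_norm_le. Qed.

Fact ell_cauchy_cvg (F : set_system ell_infty) :
  ProperFilter F -> cauchy F -> cvg F.
Proof.
move=> FF /cauchyP Fc.
have Fx x : cvg ((fun f : ell_infty => f x : R^o) @ F).
  apply/cauchy_cvgP/cauchy_exP => e e0; have [f Ff] := Fc _ e0.
  exists (f x); rewrite /fmap /=.
  apply: (@filterS _ F _ (ball f e)) Ff => g; rewrite -!ball_normE /= => fg.
  exact: le_lt_trans (ell_le_norm (f - g) x) fg.
pose l x : R^o := lim ((fun f : ell_infty => f x : R^o) @ F).
have key (e : R) f : F (ball f e) -> forall x, `|f x - l x| <= e.
  move=> Ff x; apply/ler_addgt0Pr => e' e'0.
  have /cvgrPdist_lt /(_ _ e'0) Fl := Fx x.
  have [g [gl gf]] := filter_ex (filterI Fl Ff).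
  have -> : f x - l x = (f x - g x) + (g x - l x) by rewrite addrA subrK.
  rewrite (le_trans (ler_normD _ _))// lerD//.
    move: gf; rewrite -ball_normE /= => gf.
    exact: le_trans (ell_le_norm (f - g) x) (ltW gf).
  by rewrite distrC ltW.
have lb : l \in boundedp.
  have [f Ff] := Fc _ ltr01; apply/boundedpP; exists (`|f| + 1) => x.
  have -> : l x = f x - (f x - l x) by rewrite opprB addrC subrK.
  rewrite (le_trans (ler_normB _ _))// lerD//.
    exact: ell_le_norm.
  exact: key.
apply/cvg_ex; exists (EllInfty lb); apply/cvgrPdist_le => e e0.
have e20 : 0 < e / 2 by rewrite divr_gt0.
have [f Ff] := Fc _ e20; apply: filterS (Ff) => g gf.
apply: ell_norm_leP => [|x]; first exact: ltW.
have fl : `|f x - l x| <= e / 2 := key _ _ Ff x.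
have fg : `|f x - g x| <= e / 2.
  move: gf; rewrite -ball_normE /= => gf.
  exact: le_trans (ell_le_norm (f - g) x) (ltW gf).
have -> : (EllInfty lb - g) x = (f x - g x) - (f x - l x).
  by rewrite opprB [RHS]addrC addrA subrK.
by rewrite (le_trans (ler_normB _ _))// (splitr e) lerD.
Qed.

HB.instance Definition _ := Uniform_isComplete.Build ell_infty ell_cauchy_cvg.

End EllInfty.

Arguments boundedp {R T}.

Section Retractions.
Context (R : realType) (V : normedModType R).

Definition linear_span (S : set V) : set V :=
  [set v | exists n (a : 'I_n -> R) (s : 'I_n -> V),
    (forall i, S (s i)) /\ v = \sum_(i < n) a i *: s i].

Definition closed_span (S : set V) : set V := closure (linear_span S).

Definition generating (X S : set V) : Prop := S `<=` X /\ closed_span S = X.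

(* Only the values of r on X matter. *)
Definition lipschitz_retraction (X N : set V) (r : V -> V) : Prop :=
  [/\ N `<=` X, (forall x, X x -> N (r x)), (forall x, N x -> r x = x)
    & exists2 lambda : R, 0 <= lambda & lambda.-lipschitz_X r].

End Retractions.

Section Constants.
Context (R : realType) (M : R).
Implicit Types j k : nat.

Definition x_ k : R := (1 / 2 + k%:R / M) / (1 - 2 * k%:R / M).
Definition t_ k : R := 1 / 2 - k%:R / M.
Definition alpha : R := 1 - x_ 8.
Definition beta : R := 1 + x_ 1 ^+ 2.
Definition u_ k : R := alpha + x_ k.
Definition v_ k : R := beta - x_ k ^+ 2.
Definition delta_M : R := x_ 8 ^+ 2 - x_ 1 ^+ 2.

Definition mu_term j k : R :=
  (1 - t_ k) * (u_ k - u_ j) + t_ k * (v_ k - v_ j).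

(* The initial value mu_term 1 2 is one of the values minimised over. *)
Definition mu_M : R :=
  \big[Num.min/mu_term 1 2]_(1 <= j < 9)
    \big[Num.min/mu_term 1 2]_(1 <= k < 9 | j != k) mu_term j k.

Lemma mu_M_le j k : (1 <= j <= 8)%N -> (1 <= k <= 8)%N -> j != k ->
  mu_M <= mu_term j k.
Proof.
move=> hj hk jk; rewrite /mu_M; apply: (@bigmin_inf_seq _ _ _ _ _ j) => //.
  by rewrite mem_index_iota ltnS.
by apply: (@bigmin_inf_seq _ _ _ _ _ k); rewrite // mem_index_iota ltnS.
Qed.

Lemma mu_M_attained : exists j k,
  [/\ (1 <= j <= 8)%N, (1 <= k <= 8)%N, j != k & mu_M = mu_term j k].
Proof.
pose attained r := exists j k,
  [/\ (1 <= j <= 8)%N, (1 <= k <= 8)%N, j != k & r = mu_term j k].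
have att_min a b : attained a -> attained b -> attained (Num.min a b).
  by move=> ha hb; rewrite /Num.min; case: ifP.
have att12 : attained (mu_term 1 2) by exists 1%N, 2%N.
rewrite -/(attained mu_M) /mu_M big_seq.
apply: big_ind => // j; rewrite mem_index_iota => hj.
rewrite big_seq_cond; apply: big_ind => // k /andP[].
by rewrite mem_index_iota => hk jk; exists j, k.
Qed.

End Constants.

(* The index set N = {1, 2, ...}. *)
Definition posn : Type := {n : nat | (0 < n)%N}.

(* Every y >= 1 is uniquely 8 * m + k with m >= 0 and 1 <= k <= 8; these are
   m and k. *)
Definition block (y : nat) : nat := y.-1 %/ 8.
Definition offset (y : nat) : nat := (y.-1 %% 8).+1.

Lemma blockE m k : (1 <= k <= 8)%N -> block (8 * m + k) = m.
Proof. rewrite /block; lia. Qed.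

Lemma offsetE m k : (1 <= k <= 8)%N -> offset (8 * m + k) = k.
Proof. rewrite /offset; lia. Qed.

Lemma block_offset y : (0 < y)%N ->
  y = (8 * block y + offset y)%N /\ (1 <= offset y <= 8)%N.
Proof. rewrite /block /offset; lia. Qed.

(* Only e n with 1 <= n is used: the sequence e is indexed by N and e 0 is a
   dummy.  Likewise U_ i, V_ i n are meant for 1 <= i <= 2 and 1 <= n. *)
Section Vectors.
Context (R : realType) (delta M Delta : R) (e : nat -> ell_infty R posn).
Implicit Types (i n m k : nat) (x : posn * posn).

Definition delta_ i k : R := if i == k then Delta else 0.

Definition U_fun i x : R^o :=
  let m := block (val x.2) in let k := offset (val x.2) in
  if val x.1 == 1%N then
    if m == i - 1 %[mod 2] then u_ M k else delta_ 8 k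
  else 1 / 10 * e 1 x.2.

Definition V_fun i n x : R^o :=
  let m := block (val x.2) in let k := offset (val x.2) in
  if val x.1 == 1%N then
    if m == n then
      (-1) ^+ (i - 1) * ((1 - delta) / 3 - delta_ (i + 1) k)
    else if m == n.+1 then
      v_ M k - (2 + 2 * delta) / 3 + (-1) ^+ i * delta_ 7 k
    else if m == n %[mod 2] then
      (-1) ^+ (i - 1) * ((1 - 2 * delta) / 3 - delta_ 6 k)
    else 0
  else if val x.1 == (2 * n + i - 1)%N then
    (-1) ^+ (i - 1) * ((1 - delta) / 3) * e 1 x.2
  else if val x.1 \in [:: (2 * n.+1)%N; (2 * n.+1 + 1)%N] then 0
  else 1 / 10 * e (2 * n + i - 1)%N x.2.

Lemma U_fun_same i m k x : (1 <= i <= 2)%N -> (1 <= k <= 8)%N ->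
  val x.1 = 1%N -> val x.2 = (8 * (2 * m + i - 1) + k)%N ->
  U_fun i x = u_ M k.
Proof.
move=> hi hk x1 x2; rewrite /U_fun x1 x2 eqxx blockE// offsetE//.
by rewrite ifT//; apply/eqP; lia.
Qed.

Lemma U_fun_other i m k x : (1 <= i <= 2)%N -> (1 <= m)%N ->
  (1 <= k <= 8)%N ->
  val x.1 = 1%N -> val x.2 = (8 * (2 * m - i) + k)%N ->
  U_fun i x = delta_ 8 k.
Proof.
move=> hi hm hk x1 x2; rewrite /U_fun x1 x2 eqxx blockE// offsetE//.
by rewrite ifF//; apply/negbTE/eqP; lia.
Qed.

Lemma U_fun_row i x : (2 <= val x.1)%N -> U_fun i x = 1 / 10 * e 1 x.2.
Proof. by move=> x1; rewrite /U_fun ifF//; apply/negbTE/eqP; lia. Qed.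

Lemma V_fun_block i n k x : (1 <= k <= 8)%N ->
  val x.1 = 1%N -> val x.2 = (8 * n + k)%N ->
  V_fun i n x = (-1) ^+ (i - 1) * ((1 - delta) / 3 - delta_ (i + 1) k).
Proof.
by move=> hk x1 x2; rewrite /V_fun x1 x2 eqxx blockE// offsetE// eqxx.
Qed.

Lemma V_fun_next i n k x : (1 <= k <= 8)%N ->
  val x.1 = 1%N -> val x.2 = (8 * (n + 1) + k)%N ->
  V_fun i n x = v_ M k - (2 + 2 * delta) / 3 + (-1) ^+ i * delta_ 7 k.
Proof.
move=> hk x1 x2; rewrite /V_fun x1 x2 eqxx blockE// offsetE// addn1 eqxx.
by rewrite ifF//; apply/negbTE/eqP; lia.
Qed.

Lemma V_fun_parity i n m k x : (1 <= k <= 8)%N ->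
  m = n %[mod 2] -> m <> n -> val x.1 = 1%N -> val x.2 = (8 * m + k)%N ->
  V_fun i n x = (-1) ^+ (i - 1) * ((1 - 2 * delta) / 3 - delta_ 6 k).
Proof.
move=> hk mn2 mn x1 x2; rewrite /V_fun x1 x2 eqxx blockE// offsetE//.
rewrite ifF; last exact/negbTE/eqP.
rewrite ifF; last by apply/negbTE/eqP; lia.
by rewrite ifT//; apply/eqP.
Qed.

Lemma V_fun_diag i n x : (1 <= i <= 2)%N -> (1 <= n)%N ->
  val x.1 = (2 * n + i - 1)%N ->
  V_fun i n x = (-1) ^+ (i - 1) * ((1 - delta) / 3) * e 1 x.2.
Proof.
by move=> hi hn x1; rewrite /V_fun x1 eqxx ifF//; apply/negbTE/eqP; lia.
Qed.

Lemma V_fun_row i n x : (2 <= val x.1)%N ->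
  val x.1 \notin [:: (2 * n + i - 1)%N; (2 * n.+1)%N; (2 * n.+1 + 1)%N] ->
  V_fun i n x = 1 / 10 * e (2 * n + i - 1)%N x.2.
Proof.
move=> x1; rewrite in_cons negb_or => /andP[h1 h2].
by rewrite /V_fun (negbTE h1) (negbTE h2) ifF//; apply/negbTE/eqP; lia.
Qed.

Lemma V_fun_row0 i n x : (1 <= i <= 2)%N -> (1 <= n)%N ->
  val x.1 \in [:: (2 * n.+1)%N; (2 * n.+1 + 1)%N] -> V_fun i n x = 0.
Proof.
move=> hi hn hx; rewrite /V_fun hx; move: hx.
by rewrite !inE => /orP[]/eqP->; rewrite !ifF//; apply/negbTE/eqP; lia.
Qed.

Lemma V_fun_block0 i n m k x : (1 <= k <= 8)%N -> m <> n.+1 ->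
  m <> n %[mod 2] -> val x.1 = 1%N -> val x.2 = (8 * m + k)%N ->
  V_fun i n x = 0.
Proof.
move=> hk mn mn2 x1 x2; rewrite /V_fun x1 x2 eqxx blockE// offsetE//.
by rewrite !ifF//; apply/negbTE/eqP => // mE; rewrite mE in mn2.
Qed.

Fact boundedp_offset (h : nat -> R) :
  (fun x => h (offset (val x.2)) : R^o) \in boundedp.
Proof.
apply/boundedpP; exists (\sum_(k < 9) `|h k|) => x.
have lt9 : (offset (val x.2) < 9)%N by rewrite /offset; lia.
rewrite (bigD1 (Ordinal lt9))//= lerDl; exact: sumr_ge0.
Qed.

Fact boundedp_e (a : R) n : (fun x => a * e n x.2 : R^o) \in boundedp.
Proof.
apply/boundedpP; exists (`|a| * `|e n|) => x.
by rewrite normrM ler_wpM2l// ell_le_norm.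
Qed.

Fact boundedp_if (c : pred (posn * posn)) (f g : posn * posn -> R^o) :
  f \in boundedp -> g \in boundedp ->
  (fun x => if c x then f x else g x) \in boundedp.
Proof.
move=> /boundedpP[B hB] /boundedpP[C hC]; apply/boundedpP.
exists (Num.max B C) => x; rewrite le_max.
by case: ifP => _; rewrite ?hB ?hC ?orbT.
Qed.

Fact U_fun_bounded i : U_fun i \in boundedp.
Proof.
apply: boundedp_if; last exact: boundedp_e.
apply: boundedp_if; first exact: (boundedp_offset (u_ M)).
exact: (boundedp_offset (delta_ 8)).
Qed.

Fact V_fun_bounded i n : V_fun i n \in boundedp.
Proof.
apply: boundedp_if.
  apply: boundedp_if; first exact: (boundedp_offset (fun k =>
    (-1) ^+ (i - 1) * ((1 - delta) / 3 - delta_ (i + 1) k))).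
  apply: boundedp_if; first exact: (boundedp_offset (fun k =>
    v_ M k - (2 + 2 * delta) / 3 + (-1) ^+ i * delta_ 7 k)).
  apply: boundedp_if; first exact: (boundedp_offset (fun k =>
    (-1) ^+ (i - 1) * ((1 - 2 * delta) / 3 - delta_ 6 k))).
  exact: (boundedp_offset (fun=> 0)).
apply: boundedp_if; first exact: boundedp_e.
apply: boundedp_if; first exact: (boundedp_offset (fun=> 0)).
exact: boundedp_e.
Qed.

Definition U_ i : ell_infty R (posn * posn) := EllInfty (U_fun_bounded i).
Definition V_ i n : ell_infty R (posn * posn) := EllInfty (V_fun_bounded i n).

Definition generators : set (ell_infty R (posn * posn)) :=
  [set V_ i n | i in [set 1%N; 2%N] & n in [set n | (1 <= n)%N]]
    `|` [set U_ 1; U_ 2].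

Definition space_X : set (ell_infty R (posn * posn)) := closed_span generators.

End Vectors.

(* Main.v *)
Require Import Defs.
From mathcomp Require Import all_boot all_order all_algebra.
From mathcomp Require Import all_classical all_reals all_analysis.
From mathcomp Require Import zify lra.

Set Implicit Arguments.
Unset Strict Implicit.
Unset Printing Implicit Defensive.

Import Order.TTheory GRing.Theory Num.Theory.
Import numFieldNormedType.Exports.

Local Open Scope classical_set_scope.
Local Open Scope ring_scope.

(** The generators, listed as [w_0 = U_1], [w_1 = U_2] and [w_q = V_{i,n}] for
    [q = 2 n + i - 1 >= 2], are equivalent to the unit vector basis of [l_1]:
    they are bounded, and for some constant [K], for all finite families of
    scalars,
      [\sum_q |a_q| <= K * |\sum_q a_q w_q|]
    ([basis_bounded], [basis_ell1]).  Hence the space is isomorphic to [l_1],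
    where the assertion is elementary: truncating each coordinate [a_q] to the
    interval [[-2^-q, 2^-q]] is a Lipschitz retraction onto a convex box which
    is compact because its sides are summable, and which is generating because
    it contains a multiple of every unit vector.

    The lower estimate comes from two places.  A row of index beyond the
    support of [a] reads
      [(a_0 + a_1) / 10 * e_1 + \sum_(q >= 2) a_q / 10 * e_q],
    and the [e_q] are isometrically the basis of [l_1]; so the norm controls
    [a_0 + a_1] and all [a_q] with [q >= 2] ([basis_far_estimate]).  To separate
    [a_0] from [a_1], the entry at [(1, 8)] is [a_0 + Delta a_1] plus a bounded
    combination of the other coordinates, and [Delta] is far from [1]
    ([basis_block_estimate]).

    The transfer from [l_1] ([ell1_sequence_compact_retract]) avoids infinite
    series.  The box is the closure of the set of finite combinations
    satisfying the constraints, and the retraction is the extension by density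
    of coordinatewise truncation from the finite combinations, where the lower
    estimate makes it Lipschitz. *)

(** * Closures, spans and convexity *)

(** This form of the epsilon principle absorbs the multiples of the error that
    Lipschitz estimates produce. *)
Lemma ler_addgt0_mul (R : realFieldType) (L x y : R) : 0 <= L ->
  (forall eps, 0 < eps -> x <= y + L * eps) -> x <= y.
Proof.
move=> L0 xy; apply/ler_addgt0Pr => eps eps0.
have L1 : 0 < L + 1 by rewrite ltr_wpDl.
apply: le_trans (xy _ (divr_gt0 eps0 L1)) _; rewrite lerD2l.
by rewrite mulrA ler_pdivrMr// mulrC ler_wpM2l ?lerDl// ltW.
Qed.

Section Closure.
Context (R : realType) (V : normedModType R).
Implicit Types (S P : set V) (x y : V).

Lemma closure_normP S x :
  closure S x <-> forall eps : R, 0 < eps -> exists2 s, S s & `|x - s| < eps.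
Proof.
split=> [Sx eps eps0|Sx A /nbhs_ballP[eps /= eps0 epsA]].
  have [s [Ss xs]] := Sx _ (nbhsx_ballx x eps eps0).
  by exists s => //; move: xs; rewrite -ball_normE.
have [s Ss xs] := Sx _ eps0.
by exists s; split=> //; apply: epsA; rewrite -ball_normE.
Qed.

Lemma closure_closure S : closure (closure S) = closure S.
Proof. exact/esym/closure_id/closed_closure. Qed.

Lemma linear_span_min P S : P 0 ->
  (forall (a : R) x y, P x -> P y -> P (a *: x + y)) ->
  S `<=` P -> linear_span S `<=` P.
Proof.
move=> P0 PD SP _ [n [a [s [Ss ->]]]].
apply: big_rec => // i y _ Py; apply: PD => //; exact/SP/Ss.
Qed.

Lemma closure_lincomb S : (forall (a : R) x y, S x -> S y -> S (a *: x + y)) ->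
  forall (a : R) x y, closure S x -> closure S y -> closure S (a *: x + y).
Proof.
move=> SD a x y /closure_normP Sx /closure_normP Sy.
apply/closure_normP.
move=> eps eps0; have a0 : 0 < `|a| + 1 by rewrite ltr_wpDl.
have eps20 : 0 < eps / 2 by rewrite divr_gt0.
have [s Ss xs] := Sx _ (divr_gt0 eps20 a0).
have [t St yt] := Sy _ eps20.
exists (a *: s + t); first exact: SD.
rewrite opprD addrACA -scalerBr (le_lt_trans (ler_normD _ _))// normrZ.
rewrite (splitr eps) ler_ltD//.
rewrite -[leRHS](divfK (lt0r_neq0 a0)) mulrC ler_pM//; first exact: ltW.
by rewrite lerDl.
Qed.

Lemma closure_convex S :
  (forall (a b : R) x y, 0 <= a -> 0 <= b -> a + b = 1 ->
    S x -> S y -> S (a *: x + b *: y)) ->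
  convex_set (closure S : set (convex_lmodType V)).
Proof.
move=> Sconvex x y l /set_mem/closure_normP Sx /set_mem/closure_normP Sy.
apply/mem_set/closure_normP => eps eps0.
have eps20 : 0 < eps / 2 by rewrite divr_gt0.
have [s Ss xs] := Sx _ eps20; have [t St yt] := Sy _ eps20.
have : 0 <= l%:num by []; have : 0 <= 1 - l%:num by rewrite subr_ge0.
rewrite /conv/=; move: (l%:num : R) => a b0 a0.
exists (a *: s + (1 - a) *: t).
  by apply: Sconvex => //; rewrite addrC subrK.
rewrite opprD addrACA -!scalerBr (le_lt_trans (ler_normD _ _))// !normrZ.
rewrite (ger0_norm a0) (ger0_norm b0).
have -> : eps = a * (eps / 2) + (1 - a) * (eps / 2) + eps / 2 by lra.
apply: (le_lt_trans (lerD (ler_wpM2l a0 (ltW xs)) (ler_wpM2l b0 (ltW yt)))).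
by rewrite ltrDl.
Qed.

End Closure.

(** * Compactness by compact approximation *)

Section Compactness.
Context (R : realType) (V : completeNormedModType R).

(** An ultrafilter on [N] is moved into the approximating compact set [K] by a
    choice of nearest-up-to-[eps] points; a cluster point there is the centre
    of a small ball of the original ultrafilter, which is therefore Cauchy. *)
Lemma compact_of_approx (N : set V) : closed N ->
  (forall eps : R, 0 < eps -> exists2 K, compact K &
     forall x, N x -> exists2 y, K y & `|x - y| < eps) ->
  compact N.
Proof.
move=> Nclosed Napprox; rewrite compact_ultra => F UF FN.
suff /cauchy_cvg Fcvg : cauchy F.
  exists (lim F); split; last exact: Fcvg.
  by apply: Nclosed => B /Fcvg FB; exact: filter_ex (filterI FN FB).
apply: cauchy_exP => eps eps0.
have eps20 : 0 < eps / 2 by rewrite divr_gt0.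
have [K Kcpt Kapprox] := Napprox _ eps20.
have /choice[p pP] : forall x, exists y, N x -> K y /\ `|x - y| < eps / 2.
  move=> x; have [Nx|nNx] := pselect (N x); last by exists x.
  by have [y Ky xy] := Kapprox x Nx; exists y.
have [k [_ Fk]] : K `&` cluster (p @ F) !=set0.
  apply: Kcpt; rewrite /fmap /=.
  by apply: filterS FN => x /pP[].
exists k.
have FB : F [set x | `|k - p x| < eps / 2].
  have [//|FnB] := in_ultra_setVsetC [set x | `|k - p x| < eps / 2] UF.
  have pB : (p @ F) (p @` (~` [set x | `|k - p x| < eps / 2])).
    by rewrite /fmap /=; apply: filterS FnB => x nB; exists x.
  have [_ [[x nB <-]]] := Fk _ _ pB (nbhsx_ballx k _ eps20).
  by rewrite -ball_normE => /nB.
apply: filterS (filterI FB FN) => x [kx /pP[_ xp]].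
rewrite -ball_normE /= (_ : k - x = (k - p x) - (x - p x)); last first.
  by rewrite opprB addrA subrK.
by rewrite (splitr eps) (le_lt_trans (ler_normB _ _))// ltrD.
Qed.

End Compactness.

(** * Finite combinations of a sequence *)

Section Combinations.
Context (R : realType) (V : normedModType R) (w : nat -> V).
Implicit Types (a b : nat -> R) (m n q : nat).

Definition comb n a : V := \sum_(0 <= q < n) a q *: w q.

(** Truncation pads a combination with zeros, which is how two combinations of
    different lengths are brought to a common length. *)
Definition trunc n a q : R := if (q < n)%N then a q else 0.

Lemma comb_trunc m n a : (n <= m)%N -> comb m (trunc n a) = comb n a.
Proof.
move=> nm; rewrite /comb (big_cat_nat (n := n))//= [X in _ + X]big_nat.
rewrite [X in _ + X]big1 ?addr0.
  by apply: eq_big_nat => q /andP[_ qn]; rewrite /trunc qn.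
by move=> q /andP[nq _]; rewrite /trunc ltnNge nq scale0r.
Qed.

Lemma comb_lin (c : R) n a b :
  comb n (fun q => c * a q + b q) = c *: comb n a + comb n b.
Proof.
rewrite /comb scaler_sumr -big_split; apply: eq_bigr => q _ /=.
by rewrite scalerDl scalerA.
Qed.

Lemma combZ (c : R) n a : comb n (fun q => c * a q) = c *: comb n a.
Proof.
by rewrite /comb scaler_sumr; apply: eq_bigr => q _; rewrite scalerA.
Qed.

Lemma combB n a b : comb n (fun q => a q - b q) = comb n a - comb n b.
Proof.
by rewrite /comb -sumrB; apply: eq_bigr => q _; rewrite scalerBl.
Qed.

Lemma eq_comb n a b : a =1 b -> comb n a = comb n b.
Proof. by move=> ab; apply: eq_bigr => q _; rewrite ab. Qed.

Definition finite_combs : set V := [set v | exists n a, v = comb n a].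

Lemma finite_combs_lin (c : R) x y :
  finite_combs x -> finite_combs y -> finite_combs (c *: x + y).
Proof.
move=> [n [a ->]] [m [b ->]].
exists (maxn n m), (fun q => c * trunc n a q + trunc m b q).
by rewrite comb_lin !comb_trunc ?leq_maxl ?leq_maxr.
Qed.

Lemma linear_span_range : linear_span (range w) = finite_combs.
Proof.
rewrite eqEsubset; split.
  apply: linear_span_min; first by exists 0%N, (fun=> 0); rewrite /comb big_nil.
    exact: finite_combs_lin.
  move=> _ [q _ <-]; exists q.+1, (fun i => (i == q)%:R).
  rewrite /comb big_nat_recr//= eqxx scale1r big_nat big1 ?add0r// => i.
  by move=> /andP[_ iq]; rewrite ltn_eqF// scale0r.
move=> _ [n [a ->]]; exists n, (fun i => a i), (fun i => w i); split=> [i|].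
  by exists (i : nat).
by rewrite /comb big_mkord.
Qed.

End Combinations.

(** * The coordinate box of a sequence equivalent to the basis of l_1 *)

Section HalfPowers.
Context {R : realType}.
Implicit Types (a b : nat -> R) (m n q : nat).

Definition half_pow q : R := 2^-1 ^+ q.

Lemma half_pow_gt0 q : 0 < half_pow q.
Proof. by rewrite exprn_gt0 ?invr_gt0. Qed.

Lemma sum_half_pow_le n k : \sum_(n <= q < n + k) half_pow q <= 2 * half_pow n.
Proof.
suff -> : \sum_(n <= q < n + k) half_pow q =
    2 * (half_pow n - half_pow (n + k)).
  by rewrite ler_wpM2l// gerBl ltW// half_pow_gt0.
elim: k => [|k IHk]; first by rewrite addn0 big_geq// subrr mulr0.
have hS : half_pow (n + k).+1 = half_pow (n + k) / 2.
  by rewrite /half_pow exprSr.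
rewrite addnS big_nat_recr ?leq_addr//= IHk hS; lra.
Qed.

Lemma half_pow_small (eps : R) : 0 < eps -> exists n, half_pow n < eps.
Proof.
move=> eps0; have /cvg_expr/cvgrPdist_lt/(_ _ eps0)[n _ nP] : `|2^-1 : R| < 1.
  by rewrite ger0_norm ?invr_ge0// invf_lt1// ltr1n.
exists n; have := nP n (leqnn n); rewrite /= sub0r normrN.
exact/le_lt_trans/ler_norm.
Qed.

Definition in_box a := forall q, `|a q| <= half_pow q.

Lemma trunc_in_box n a : in_box a -> in_box (trunc n a).
Proof.
move=> aB q; rewrite /trunc; case: ifP => // _.
by rewrite normr0 ltW// half_pow_gt0.
Qed.

Definition clamp a q : R := Num.max (- half_pow q) (Num.min (half_pow q) (a q)).

Lemma clamp_in_box a : in_box (clamp a).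
Proof.
move=> q; have h0 := half_pow_gt0 q; rewrite ler_norml le_max lexx /=.
by rewrite ge_max ge_min lexx andbT /=; lra.
Qed.

Lemma clamp_id a : in_box a -> clamp a =1 a.
Proof.
move=> aB q; have := aB q; rewrite ler_norml => /andP[aq1 aq2].
by rewrite /clamp min_r// max_r.
Qed.

Lemma clamp_nonexpansive a b q : `|clamp a q - clamp b q| <= `|a q - b q|.
Proof.
have h0 := half_pow_gt0 q; rewrite /clamp.
move: (half_pow q) (a q) (b q) h0 => h s t h0.
have mono (x y : R) : x <= y ->
    `|Num.max (- h) (Num.min h x) - Num.max (- h) (Num.min h y)| <= `|x - y|.
  move=> xy; rewrite [leRHS]distrC [leRHS]ger0_norm ?subr_ge0// ler_norml.
  have [hx|hx] := leP h x; have [hy|hy] := leP h y;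
    do ![have [?|?] := leP (- h) _]; apply/andP; split; lra.
by have [/mono//|/ltW/mono] := leP s t; rewrite distrC [leRHS]distrC.
Qed.

Lemma clamp_trunc n a : clamp (trunc n a) =1 trunc n (clamp a).
Proof.
move=> q; rewrite /clamp /trunc; case: ifP => // _.
by have h0 := half_pow_gt0 q; rewrite min_r ?max_r//; lra.
Qed.

End HalfPowers.

Section EllOneSequence.
Context (R : realType) (V : completeNormedModType R).
Context (w : nat -> V) (C K : R).
Hypothesis w_le : forall q, `|w q| <= C.
Hypothesis w_ge : forall n (a : nat -> R),
  \sum_(0 <= q < n) `|a q| <= K * `|comb w n a|.
Implicit Types (a b : nat -> R) (m n q : nat).

Local Notation comb := (comb w).
Local Notation finite_combs := (finite_combs w).

Lemma C_ge0 : 0 <= C.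
Proof. exact: le_trans (w_le 0). Qed.

Lemma norm_comb_le n a : `|comb n a| <= C * \sum_(0 <= q < n) `|a q|.
Proof.
rewrite (le_trans (ler_norm_sum _ _ _))// mulr_sumr ler_sum// => q _.
by rewrite normrZ mulrC ler_wpM2r.
Qed.

(** In coordinates truncation is nonexpansive for the [l_1] norm; the two
    comparisons of norms cost the factors [C] and [K].  Applied to two
    representations of one vector, this also says that the truncated
    combination depends only on the vector. *)
Lemma clamp_comb_lipschitz n a m b :
  `|comb n (clamp a) - comb m (clamp b)| <= C * K * `|comb n a - comb m b|.
Proof.
pose l := maxn n m.
rewrite -(comb_trunc w a (leq_maxl n m)) -(comb_trunc w b (leq_maxr n m)).
rewrite -(comb_trunc w (clamp a) (leq_maxl n m)).
rewrite -(comb_trunc w (clamp b) (leq_maxr n m)).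
rewrite -(eq_comb w _ (clamp_trunc n a)) -(eq_comb w _ (clamp_trunc m b)).
rewrite -!combB.
rewrite (le_trans (norm_comb_le _ _))// -mulrA ler_wpM2l ?C_ge0//.
rewrite (le_trans _ (w_ge _ _))// ler_sum// => q _.
exact: clamp_nonexpansive.
Qed.

Lemma CK_ge0 : 0 <= C * K.
Proof.
have w1 : 1 <= K * `|w 0|.
  by have := w_ge 1 (fun=> 1); rewrite /comb !big_nat1 scale1r normr1.
rewrite mulr_ge0 ?C_ge0// leNgt; apply/negP => K0; move: w1.
by apply/negP; rewrite -ltNge (le_lt_trans _ ltr01)// mulr_le0_ge0// ltW.
Qed.

Definition finite_box : set V :=
  [set v | exists n a, in_box a /\ v = comb n a].

Definition box : set V := closure finite_box.

Lemma finite_box_combs : finite_box `<=` finite_combs.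
Proof. by move=> _ [n [a [_ ->]]]; exists n, a. Qed.

Lemma finite_box_convex (s t : R) x y : 0 <= s -> 0 <= t -> s + t = 1 ->
  finite_box x -> finite_box y -> finite_box (s *: x + t *: y).
Proof.
move=> s0 t0 st1 [n [a [aB ->]]] [m [b [bB ->]]].
exists (maxn n m), (fun q => s * trunc n a q + t * trunc m b q); split.
  move=> q; rewrite (le_trans (ler_normD _ _))// !normrM.
  rewrite (ger0_norm s0) (ger0_norm t0).
  rewrite -[leRHS]mul1r -st1 mulrDl lerD// ler_wpM2l// trunc_in_box//.
by rewrite comb_lin combZ !comb_trunc ?leq_maxl ?leq_maxr.
Qed.

Lemma box_tail n m a : in_box a -> (n <= m)%N ->
  `|comb m a - comb n a| <= C * (2 * half_pow n).
Proof.
move=> aB nm; rewrite /comb (big_cat_nat (n := n))//= addrAC subrr add0r.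
rewrite (le_trans (ler_norm_sum _ _ _))// -(subnKC nm).
rewrite (le_trans _ (ler_wpM2l C_ge0 (sum_half_pow_le n (m - n))))//.
rewrite mulr_sumr ler_sum// => q _; rewrite normrZ mulrC.
by rewrite ler_pM.
Qed.

(** The combinations of length [n] with coefficients in the box fill a
    parallelotope, the sum of the one of length [n - 1] and a segment. *)
Lemma comb_box_compact n :
  exists2 B : set V, compact B & forall a, in_box a -> B (comb n a).
Proof.
elim: n => [|n [B Bcpt Ba]].
  by exists [set 0]; [exact: compact_set1|move=> a _; rewrite /comb big_nil].
exists ((fun p : V * R^o => p.1 + p.2 *: w n) @`
        (B `*` `[- half_pow n, half_pow n])).
  apply: continuous_compact; last exact/compact_setX/segment_compact.
  apply: continuous_subspaceT => p; apply: cvgD; first exact: cvg_fst.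
  by apply: cvgZr_tmp; exact: cvg_snd.
move=> a aB; exists (comb n a, a n) => /=; last by rewrite /comb big_nat_recr.
by split; [exact: Ba|rewrite /= in_itv/= -ler_norml].
Qed.

(** Truncating combinations to length [n] moves the box by at most the tail of
    a geometric series. *)
Lemma box_compact : compact box.
Proof.
apply: compact_of_approx => [|eps eps0]; first exact: closed_closure.
have e0 : 0 < eps / 4 / (C + 1) by rewrite !divr_gt0// ltr_wpDl// C_ge0.
have [n nP] := half_pow_small e0.
have tail : C * (2 * half_pow n) <= eps / 2.
  have : (C + 1) * half_pow n < eps / 4.
    by rewrite mulrC -ltr_pdivlMr// ltr_wpDl// C_ge0.
  have := half_pow_gt0 (R := R) n; lra.
have [B Bcpt Ba] := comb_box_compact n; exists B => // x /closure_normP.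
move=> /(_ (eps / 2)) [|_ [m [a [aB ->]]] xa]; first by rewrite divr_gt0.
have tB := trunc_in_box m aB.
exists (comb n (trunc m a)); first exact: Ba.
rewrite -(comb_trunc w a (leq_maxl m n)) in xa.
rewrite -[x](subrK (comb (maxn m n) (trunc m a))) -addrA.
rewrite (splitr eps) (le_lt_trans (ler_normD _ _))// ltr_leD//.
exact: le_trans (box_tail tB (leq_maxr m n)) tail.
Qed.

Lemma box_generating : generating (closed_span (range w)) box.
Proof.
rewrite /generating /closed_span linear_span_range; split.
  exact/closureS/finite_box_combs.
have combs0 : finite_combs 0 by exists 0%N, (fun=> 0); rewrite /comb big_nil.
rewrite eqEsubset; split.
  rewrite -[X in _ `<=` X]closure_closure; apply: closureS.
  apply: linear_span_min.
  - exact: subset_closure.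
  - exact/closure_lincomb/finite_combs_lin.
  - exact/closureS/finite_box_combs.
apply: closureS => _ [n [a ->]].
exists n, (fun i => a i / half_pow i), (fun i => half_pow i *: w i).
split=> [i|].
  apply: subset_closure; exists i.+1.
  exists (fun q => if q == i then half_pow q else 0).
  split=> [q|].
    by case: ifP => _; rewrite ?normr0 ?ger0_norm// ltW// half_pow_gt0.
  rewrite /comb big_nat_recr//= eqxx big_nat big1 ?add0r// => q /andP[_ qi].
  by rewrite ltn_eqF// scale0r.
rewrite /comb big_mkord; apply: eq_bigr => i _.
by rewrite scalerA divfK// gt_eqF// half_pow_gt0.
Qed.

(** Extension by density: along approximations of [x] by finite combinations
    the truncated combinations form a Cauchy sequence.  Approximating [x] and
    its image by the same combination is all that is used of the limit. *)
Lemma box_retraction_value x : closure finite_combs x ->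
  exists y, forall eps : R, 0 < eps -> exists n a,
    `|x - comb n a| < eps /\ `|y - comb n (clamp a)| < eps.
Proof.
move=> /closure_normP xC.
have /choice[f fP] (k : nat) : exists p : nat * (nat -> R),
    `|x - comb p.1 p.2| < half_pow k.
  by have [_ [n [a ->]] xk] := xC _ (half_pow_gt0 k); exists (n, a).
pose s k := comb (f k).1 (clamp (f k).2).
have sP k l : (k <= l)%N -> `|s k - s l| <= C * K * (2 * half_pow k).
  move=> kl; rewrite (le_trans (clamp_comb_lipschitz _ _ _ _))//.
  rewrite ler_wpM2l ?CK_ge0//.
  rewrite -[X in X - _](subrK x) -addrA (le_trans (ler_normD _ _))//.
  rewrite mulr_natl mulr2n lerD//; first by rewrite distrC ltW.
  rewrite (le_trans (ltW (fP l)))// ler_wiXn2l// ?invr_ge0// invf_le1//.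
  by rewrite ler1n.
have CK10 : 0 < 2 * (C * K) + 1 by have := CK_ge0; lra.
have smallP (eps : R) : 0 < eps -> exists k,
    C * K * (2 * half_pow k) < eps /\ half_pow k < eps.
  move=> eps0.
  have [k] := half_pow_small (divr_gt0 eps0 CK10).
  rewrite ltr_pdivlMr// => kP; exists k.
  by have := half_pow_gt0 (R := R) k; have := CK_ge0; split; nra.
have scvg : cvg (s @ \oo).
  apply/cauchy_cvgP/cauchy_exP => eps eps0; have [k [kP _]] := smallP _ eps0.
  exists (s k), k => // l /= kl; rewrite -ball_normE /=.
  exact: le_lt_trans (sP k l kl) kP.
exists (lim (s @ \oo)) => eps eps0.
have /cvgrPdist_lt/(_ _ eps0)[k0 _ k0P] := scvg.
have [k1 [_ k1P]] := smallP _ eps0.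
exists (f (maxn k0 k1)).1, (f (maxn k0 k1)).2; split.
  rewrite (lt_trans (fP _))// (le_lt_trans _ k1P)//.
  by rewrite ler_wiXn2l ?leq_maxr ?invr_ge0// invf_le1// ler1n.
exact/k0P/leq_maxl.
Qed.

(** The closed span is a copy of [l_1], and [r x] is the truncation of [x].
    Each property holds for finite combinations, and passes to limits because
    [x] and [r x] are approximated through the same combination. *)
Theorem ell1_sequence_compact_retract : exists (N : set V) (r : V -> V),
  [/\ generating (closed_span (range w)) N, compact N,
      convex_set (N : set (convex_lmodType V))
    & lipschitz_retraction (closed_span (range w)) N r].
Proof.
have /choice[r rP] x : exists y, closure finite_combs x ->
    forall eps : R, 0 < eps -> exists n a,
      `|x - comb n a| < eps /\ `|y - comb n (clamp a)| < eps.
  have [/box_retraction_value[y yP]|] := pselect (closure finite_combs x).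
    by exists y.
  by exists x.
exists box, r; split; [exact: box_generating|exact: box_compact| |].
  exact/closure_convex/finite_box_convex.
rewrite /closed_span linear_span_range.
have boxX : box `<=` closure finite_combs := closureS finite_box_combs.
have CK0 := CK_ge0.
have rcomb x n a : closure finite_combs x ->
    `|r x - comb n (clamp a)| <= C * K * `|x - comb n a|.
  move=> Xx.
  apply: (@ler_addgt0_mul _ (C * K + 1)) => [|eps eps0]; first by lra.
  have [m [b [xb rb]]] := rP x Xx _ eps0.
  have := ler_distD (comb m (clamp b)) (r x) (comb n (clamp a)).
  have := clamp_comb_lipschitz m b n a.
  have /(ler_wpM2l CK0) := ler_distD x (comb m b) (comb n a).
  have := ler_wpM2l CK0 (ltW xb); rewrite [`|comb m b - x|]distrC; lra.
split=> //.
- move=> x Xx; apply/closure_normP => eps eps0.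
  have [n [a [_ ra]]] := rP x Xx _ eps0.
  exists (comb n (clamp a)) => //; exists n, (clamp a).
  by split=> //; exact: clamp_in_box.
- move=> x Bx; apply/eqP; rewrite -subr_eq0 -normr_le0.
  apply: (@ler_addgt0_mul _ (C * K + 1)) => [|eps eps0]; first by lra.
  have /closure_normP/(_ _ eps0)[_ [n [a [aB ->]]] xa] := Bx.
  have := rcomb x n a (boxX _ Bx); rewrite (eq_comb w _ (clamp_id aB)).
  have := ler_distD (comb n a) (r x) x; rewrite [`|comb n a - x|]distrC.
  have := ler_wpM2l CK0 (ltW xa); lra.
- exists (C * K) => // -[x y] [/= Xx Xy] /=.
  apply: (@ler_addgt0_mul _ (C * K + 1)) => [|eps eps0]; first by lra.
  have [n [a [ya rya]]] := rP y Xy _ eps0.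
  have := rcomb x n a Xx.
  have /(ler_wpM2l CK0) := ler_distD y x (comb n a).
  have := ler_wpM2l CK0 (ltW ya).
  have := ler_distD (comb n (clamp a)) (r x) (r y).
  rewrite [`|comb n (clamp a) - r y|]distrC; lra.
Qed.

End EllOneSequence.

(** * The generators are equivalent to the basis of l_1 *)

Lemma ell_sumE (R : realType) (T : Type) m n (F : nat -> ell_infty R T) x :
  (\sum_(m <= q < n) F q) x = \sum_(m <= q < n) F q x.
Proof.
elim: n => [|n IHn]; first by rewrite !big_geq.
have [mn|nm] := leqP m n; last by rewrite !big_geq.
by rewrite !big_nat_recr// ell_addE IHn.
Qed.

Section Generators.
Context (R : realType) (delta M Delta : R) (e : nat -> ell_infty R posn).

Local Notation U_ := (U_ M Delta e).
Local Notation V_ := (V_ delta M Delta e).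

(** With this numbering [V_{i,n}] has index [2 n + i - 1], which is both the
    row where it is exceptional and the index of the vector [e] in its other
    rows. *)
Definition basis q : ell_infty R (posn * posn) :=
  match q with 0 => U_ 1 | 1 => U_ 2 | _ => V_ (odd q).+1 q./2 end.

Lemma range_basis : range basis = generators delta M Delta e.
Proof.
rewrite eqEsubset; split=> [_ [[|[|q]] _ <-]|_ [[i i12 [n n1 <-]]|[->|->]]] /=.
- by right; left.
- by right; right.
- left; exists (odd q.+2).+1; first by case: odd; [right|left].
  by exists q.+2./2.
- exists (2 * n + i - 1)%N => //.
  have [m mE] : exists m, (2 * n + i - 1 = m.+2)%N.
    by exists (2 * n + i - 3)%N; case: i12 => ->; move: n1 => /=; lia.
  rewrite mE [basis _](_ : _ = V_ (odd m.+2).+1 m.+2./2)//; congr Defs.V_.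
    by case: i12 mE => ->; lia.
  by case: i12 mE => ->; lia.
- by exists 0%N.
- by exists 1%N.
Qed.

(** The rows in which [w_q] is exceptional or vanishes have index at most
    [q + 3]. *)
Lemma basis_far_row q (x : posn * posn) : (q + 3 < val x.1)%N ->
  basis q x = 1 / 10 * e (maxn 1 q) x.2.
Proof.
case: q => [|[|q]] qx; rewrite /basis.
- by rewrite /= U_fun_row//; lia.
- by rewrite /= U_fun_row//; lia.
- rewrite [LHS]V_fun_row; first by congr (_ * e _ _); lia.
    by lia.
  by rewrite !inE; lia.
Qed.

Lemma u_8 : u_ M 8 = 1.
Proof. by rewrite /u_ /alpha subrK. Qed.

Hypothesis delta_lt : delta < 1 / 10.
Hypothesis Delta_gt0 : 0 < Delta.
Hypothesis Delta_lt : Delta < delta / 6.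
Hypothesis e_norm1 : forall n : nat, (1 <= n)%N -> `|e n| = 1.
Hypothesis e_l1 : forall (N : nat) (lambda : nat -> R),
  `|\sum_(1 <= n < N) lambda n *: e n| = \sum_(1 <= n < N) `|lambda n|.

Lemma delta_bound i k : 0 <= delta_ Delta i k <= Delta.
Proof. by rewrite /delta_; case: eqP => _; rewrite ?lexx ltW. Qed.

Lemma e_entry_le n y : (1 <= n)%N -> `|e n y| <= 1.
Proof. by move=> n1; rewrite (le_trans (ell_le_norm _ _))// e_norm1. Qed.

(** The sum over [k < 9] dominates [v(k)] at every offset [k]. *)
Definition V_bound : R := 3 + \sum_(k < 9) `|v_ M k|.

Lemma V_bound_ge : 3 <= V_bound.
Proof. by rewrite lerDl sumr_ge0. Qed.

Lemma V_le i n : (1 <= i)%N -> (1 <= n)%N -> `|V_ i n| <= V_bound.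
Proof.
move=> i1 n1; have B3 := V_bound_ge.
have := (Delta_gt0, Delta_lt, delta_lt) => -[[? ?] ?].
apply: ell_norm_leP => [|[x y]] /=; first by lra.
rewrite /V_fun /=; set k := offset _.
have scaled (c : R) m : (1 <= m)%N -> 0 <= c <= 3 -> `|c * e m y| <= V_bound.
  move=> m1 /andP[c0 c3]; rewrite normrM (ger0_norm c0).
  rewrite (le_trans (ler_wpM2l c0 (e_entry_le y m1)))//; lra.
have shifted (c : R) m : 0 <= c <= 1 -> `|c - delta_ Delta m k| <= V_bound.
  have /andP[? ?] := delta_bound m k => /andP[? ?].
  by rewrite ler_norml; apply/andP; split; lra.
case: ifP => _.
  case: ifP => _; first by rewrite normrMsign shifted//; apply/andP; split; lra.
  case: ifP => _.
    have vk : `|v_ M k| <= \sum_(k < 9) `|v_ M k|.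
      have k9 : (k < 9)%N by rewrite /k /offset; lia.
      by rewrite (bigD1 (Ordinal k9))//= lerDl sumr_ge0.
    have d7 : `|(-1) ^+ i * delta_ Delta 7 k| <= Delta.
      by have /andP[? ?] := delta_bound 7 k; rewrite normrMsign ger0_norm.
    rewrite (le_trans (ler_normD _ _))// (le_trans (lerD (ler_normB _ _) d7))//.
    rewrite (ger0_norm (_ : 0 <= (2 + 2 * delta) / 3)); last by lra.
    by rewrite /V_bound; lra.
  case: ifP => _; last by rewrite normr0; lra.
  by rewrite normrMsign shifted//; apply/andP; split; lra.
case: ifP => _.
  by rewrite -mulrA normrMsign scaled//; apply/andP; split; lra.
case: ifP => _; first by rewrite normr0; lra.
by rewrite scaled//; [lia|apply/andP; split; lra].
Qed.

(** The coefficient of [e_q] in a far row; [U_1] and [U_2] share [e_1]. *)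
Definition far_coef (a : nat -> R) q : R :=
  1 / 10 * (if (q == 1)%N then a 0 + a 1 else a q).

Lemma basis_far_estimate n (a : nat -> R) :
  `|a 0 + a 1| + \sum_(2 <= q < n.+2) `|a q| <= 10 * `|comb basis n.+2 a|.
Proof.
have -> : `|a 0 + a 1| + \sum_(2 <= q < n.+2) `|a q| =
    10 * `|\sum_(1 <= q < n.+2) far_coef a q *: e q|.
  rewrite e_l1 [in RHS]big_ltn// mulrDr mulr_sumr; congr (_ + _).
    by rewrite /far_coef eqxx normrM ger0_norm//; lra.
  apply: eq_big_nat => q /andP[q2 _]; rewrite /far_coef ifF.
    by rewrite normrM ger0_norm//; lra.
  by apply/negbTE; lia.
rewrite ler_wpM2l//; apply: ell_norm_leP => // y.
(* Row n + 6 is far for every index below n + 2. *)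
pose x : posn * posn := (exist _ (n + 6)%N (ltn_addl n (ltn0Sn 5)), y).
apply: le_trans (ell_le_norm _ x).
suff -> : (\sum_(1 <= q < n.+2) far_coef a q *: e q) y = comb basis n.+2 a x.
  by [].
have row q : (q < n.+2)%N -> basis q x = 1 / 10 * e (maxn 1 q) y.
  by move=> qn; rewrite basis_far_row//= ; lia.
rewrite /comb !ell_sumE big_ltn// [RHS]big_ltn// [in RHS]big_ltn// addrA.
congr (_ + _).
  by rewrite !ell_scaleE !row// maxn0 maxnn /far_coef eqxx; lra.
apply: eq_big_nat => q /andP[q2 qn]; rewrite !ell_scaleE row// /far_coef.
by rewrite ifF ?(maxn_idPr _); [lra|lia|apply/negbTE; lia].
Qed.

(** At the last point of block [0] the vector [U_1] has entry [u(8) = 1] and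
    [U_2] has entry [Delta]. *)
Lemma basis_block_estimate n (a : nat -> R) :
  `|a 0 + Delta * a 1| <=
    `|comb basis n.+2 a| + V_bound * \sum_(2 <= q < n.+2) `|a q|.
Proof.
pose x : posn * posn := (exist _ 1%N (ltn0Sn 0), exist _ 8 (ltn0Sn 7)).
have b0 : basis 0 x = 1.
  by rewrite /= (@U_fun_same _ _ _ _ 1 0 8)// u_8.
have b1 : basis 1 x = Delta.
  by rewrite /= (@U_fun_other _ _ _ _ 2 1 8).
have -> : a 0 + Delta * a 1 =
    comb basis n.+2 a x - \sum_(2 <= q < n.+2) a q * basis q x.
  rewrite /comb ell_sumE big_ltn// [in RHS]big_ltn// !ell_scaleE b0 b1; lra.
rewrite (le_trans (ler_normB _ _))// lerD//; first exact: ell_le_norm.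
rewrite mulr_sumr (le_trans (ler_norm_sum _ _ _))// big_nat [leRHS]big_nat.
apply: ler_sum => q /andP[q2 _]; rewrite normrM mulrC ler_wpM2r//.
apply: le_trans (ell_le_norm _ _) _; case: q q2 => [|[|q]]// _.
by apply: V_le => //=; lia.
Qed.

(** Subtracting [Delta] times the far estimate from the block estimate isolates
    [(1 - Delta) a_0].  With [Z] the norm and [A] the sum over [q >= 2] this
    gives [A <= 10 Z], [|a_0| <= 2 (11 Z + V_bound A)] and
    [|a_1| <= |a_0| + 10 Z], whence the constant. *)
Lemma basis_ell1 n (a : nat -> R) :
  \sum_(0 <= q < n) `|a q| <= (64 + 40 * V_bound) * `|comb basis n a|.
Proof.
have : \sum_(0 <= q < n) `|a q| <= \sum_(0 <= q < n.+2) `|trunc n a q|.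
  rewrite [leRHS](@big_cat_nat _ _ _ n)//=; last by lia.
  rewrite [leLHS](_ : _ = \sum_(0 <= q < n) `|trunc n a q|).
    by rewrite lerDl sumr_ge0.
  by apply: eq_big_nat => q /andP[_ qn]; rewrite /trunc qn.
move/le_trans; apply; rewrite -(comb_trunc _ _ (leqW (leqnSn n))).
move: (trunc n a) => {}a.
have far := basis_far_estimate n a; have near := basis_block_estimate n a.
have := (Delta_gt0, Delta_lt, delta_lt, V_bound_ge) => -[[[? ?] ?] B3].
rewrite big_ltn// [X in _ + X]big_ltn//.
move: (comb basis n.+2 a) far near => z.
have : 0 <= \sum_(2 <= q < n.+2) `|a q| by rewrite sumr_ge0.
move: (\sum_(2 <= q < n.+2) `|a q|) => A A0 far near.
have a0_le : (1 - Delta) * `|a 0| <= `|a 0 + Delta * a 1| + `|a 0 + a 1|.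
  rewrite -[leLHS]ger0_norm ?mulr_ge0//; last by lra.
  rewrite normrM normr_id -normrM.
  have -> : (1 - Delta) * a 0 = (a 0 + Delta * a 1) - Delta * (a 0 + a 1).
    by lra.
  rewrite (le_trans (ler_normB _ _))// lerD2l normrM ger0_norm; last by lra.
  by rewrite ler_piMl//; lra.
have a1_le : `|a 1| <= `|a 0 + a 1| + `|a 0|.
  by have := ler_normB (a 0 + a 1) (a 0); rewrite addrAC subrr add0r.
have a0_half : `|a 0| / 2 <= (1 - Delta) * `|a 0|.
  by rewrite mulrC ler_wpM2r//; lra.
have : V_bound * A <= V_bound * (10 * `|z|).
  by rewrite ler_wpM2l//; [lra|have := normr_ge0 (a 0 + a 1); lra].
have := normr_ge0 (a 0 + a 1); lra.
Qed.

Lemma basis_bounded : exists C : R, forall q, `|basis q| <= C.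
Proof.
exists (V_bound + `|U_ 1| + `|U_ 2|) => q; have B3 := V_bound_ge.
have : 0 <= `|U_ 1| by []; have : 0 <= `|U_ 2| by [].
case: q => [|[|q]] ? ?; rewrite /basis; [lra|lra|].
by have : `|V_ (odd q.+2).+1 q.+2./2| <= V_bound by [apply: V_le|]; lra.
Qed.

End Generators.

Theorem corollary2p10 (R : realType) (delta M Delta : R)
  (e : nat -> ell_infty R posn)
  (delta_gt0 : 0 < delta) (delta_lt : delta < 1 / 10)
  (M_gt16 : 16 < M)
  (M_large : 8 / M + delta_M M + mu_M M < (1 - 8 * delta) / 6)
  (delta_M_lt : delta_M M < delta / 3)
  (Delta_gt0 : 0 < Delta)
  (Delta_lt1 : Delta < mu_M M / 2)
  (Delta_lt2 : Delta < delta / 6)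
  (Delta_lt3 : Delta < (1 - 2 * delta) / 3 - delta_M M)
  (Delta_lt4 : Delta < delta_M M)
  (Delta_lt5 : Delta < (1 - delta_M M) / 2)
  (e_norm1 : forall n : nat, (1 <= n)%N -> `|e n| = 1)
  (e_l1 : forall (N : nat) (lambda : nat -> R),
    `|\sum_(1 <= n < N) lambda n *: e n| = \sum_(1 <= n < N) `|lambda n|) :
  let X := space_X delta M Delta e in
  exists (N : set (ell_infty R (posn * posn)))
         (r : ell_infty R (posn * posn) -> ell_infty R (posn * posn)),
    [/\ generating X N,
        compact N,
        convex_set (N : set (convex_lmodType (ell_infty R (posn * posn))))
      & lipschitz_retraction X N r].
Proof.
have [C C_ub] := basis_bounded M delta_lt Delta_gt0 Delta_lt2 e_norm1.
move=> X; rewrite /X /space_X -range_basis.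
have basis_lower := basis_ell1 M delta_lt Delta_gt0 Delta_lt2 e_norm1 e_l1.
exact: ell1_sequence_compact_retract C_ub basis_lower.
Qed.
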